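(* Let $N\ge 3$, $\alpha>0$, $\beta\in\mathbb{R}$, $k\in\{0,\dots,N-1\}$, $c=\cos(2\pi k/N)$, $s=\sin(2\pi k/N)$, and let $F$ be the $2N\times 2N$ real matrix $$F=\frac12\left(\begin{bmatrix}-1&0\\4\alpha&0\end{bmatrix}\otimes I+\begin{bmatrix}0&\beta c\\-\beta c&0\end{bmatrix}\otimes L+\begin{bmatrix}-\beta s&0\\0&-\beta s\end{bmatrix}\otimes M\right).$$ Let $0=\lambda_1\le\lambda_2\le\dots\le\lambda_N$ be the eigenvalues of $L$ and $x_i=\beta c\,\lambda_i$. Then $0$ is an eigenvalue of $F$, and the remaining $2N-1$ eigenvalues of $F$ (counted with algebraic multiplicity) all have negative real part if and only if $$4\alpha x_i-x_i^2<0\quad\text{for all } i=2,\dots,N.$$ In particular, the remaining $2N-1$ eigenvalues all have negative real part if $\beta\cos(2\pi k/N)<0$, and also if $\beta\cos(2\pi k/N)>\alpha\csc^2(\pi/N)$.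
   Context: $I$ is the $N\times N$ identity. $L$ is the $N\times N$ Laplacian matrix of the ring (cycle graph): $L_{ii}=2$, $L_{ij}=-1$ if $i\equiv j\pm1 \pmod N$, and $0$ otherwise; its eigenvalues are $4\sin^2(j\pi/N)$, $j=0,\dots,N-1$. $M$ is the $N\times N$ matrix with $M_{ij}=1$ if $i\equiv j+1$, $M_{ij}=-1$ if $i\equiv j-1 \pmod N$, and $0$ otherwise. $F$ is the matrix used as the linearized state matrix, in the variables (amplitude deviations $\delta a$, phase deviations $\delta\phi$), of a ring of $N$ coupled oscillators around its rotating-wave solution with wavenumber $k$; the zero eigenvalue corresponds to displacement along the limit cycle, and the wave is called locally stable when all other eigenvalues have negative real part. *)

(* Defs.v *)
From HB Require Import structures.
From mathcomp Require Import all_boot all_order all_algebra.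
From mathcomp Require Import all_classical all_reals all_analysis.
From mathcomp Require Import complex mxtens.

Set Implicit Arguments.
Unset Strict Implicit.
Unset Printing Implicit Defensive.

Import Order.TTheory GRing.Theory Num.Theory.
Local Open Scope ring_scope.

(* The complex eigenvalues of a real matrix, each repeated according to its
   algebraic multiplicity, in an unspecified order: the roots of the
   characteristic polynomial, which is monic, so the leading coefficient in
   closed_field_poly_normal is 1. *)
Definition eigenvalues (R : realType) (n : nat) (A : 'M[R]_n) : seq R[i] :=
  sval (closed_field_poly_normal (char_poly (map_mx (real_complex R) A))).

(* All eigenvalues of A are real, and lam lists them with multiplicity in
   nondecreasing order.  Such a lam is unique if it exists. *)
Definition ordered_real_eigenvalues (R : realType) (n : nat) (A : 'M[R]_n)
    (lam : seq R) : Prop :=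
  sorted <=%R lam /\ perm_eq (eigenvalues A) (map (real_complex R) lam).

(* rem deletes a single occurrence of 0, so a multiple eigenvalue 0 still
   violates the condition. *)
Definition remaining_eigenvalues_neg (R : realType) (n : nat) (A : 'M[R]_n) :
    Prop :=
  forall z : R[i], z \in rem 0 (eigenvalues A) -> complex.Re z < 0.

Definition mx22 (R : realType) (a b c d : R) : 'M[R]_2 :=
  \matrix_(i, j) if i == 0 then (if j == 0 then a else b)
                 else (if j == 0 then c else d).

(* Ring vertices are indexed by 0, ..., N-1; the congruence i = j - 1 mod N is
   written j = i + 1 mod N to avoid truncated subtraction. *)
Definition ring_laplacian (R : realType) (N : nat) : 'M[R]_N :=
  \matrix_(i < N, j < N)
    if i == j then 2
    else if (i == j + 1 %[mod N])%N || (j == i + 1 %[mod N])%N then -1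
    else 0.

Definition ring_skew (R : realType) (N : nat) : 'M[R]_N :=
  \matrix_(i < N, j < N)
    if (i == j + 1 %[mod N])%N then 1
    else if (j == i + 1 %[mod N])%N then -1
    else 0.

(* tensmx, written *t, is the Kronecker product, with the index (i, p) of
   A *t B encoded as i * N + p; thus the first N coordinates are the amplitude
   deviations and the last N are the phase deviations. *)
Definition state_matrix (R : realType) (N : nat) (alpha beta c s : R) :
    'M[R]_(2 * N) :=
  2^-1 *: (mx22 (-1) 0 (4 * alpha) 0 *t 1%:M
           + mx22 0 (beta * c) (- (beta * c)) 0 *t ring_laplacian R N
           + mx22 (- (beta * s)) 0 0 (- (beta * s)) *t ring_skew R N).

(* Main.v *)
Require Import Defs.
From HB Require Import structures.
From mathcomp Require Import all_boot all_order all_algebra.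
From mathcomp Require Import all_classical all_reals all_analysis.
From mathcomp Require Import complex mxtens.
From mathcomp Require Import ring lra zify.

Set Implicit Arguments.
Unset Strict Implicit.
Unset Printing Implicit Defensive.

Import Order.TTheory GRing.Theory Num.Theory.
Local Open Scope ring_scope.

(** The discrete Fourier basis diagonalises the two circulant matrices
    simultaneously, so [F] is similar to a matrix made of [N] blocks of size 2,
    one for each Fourier mode [j].  Since the skew part contributes a purely
    imaginary shift [- i t], the block of mode [j] has the eigenvalues [w - i t]
    with [w^2 + w/2 = (4 alpha x - x^2) / 4], where [x = beta c lambda_j]: both
    have negative real part iff the right-hand side is negative.  Mode [0] gives
    [0] and [- 1/2].  The bounds of the last part follow from
    [lambda_j = 4 sin^2 (j pi / N) >= 4 sin^2 (pi / N)] for [0 < j < N]. *)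

(** * Determinants and characteristic polynomials of block matrices *)

Lemma char_poly_similar (K : fieldType) n (P A B : 'M[K]_n) :
  P \in unitmx -> A *m P = P *m B -> char_poly A = char_poly B.
Proof.
move=> uP AP; have dP : \det (map_mx polyC P) != 0.
  by rewrite det_map_mx polyC_eq0 -unitfE -unitmxE.
apply: (mulIf dP); rewrite [RHS]mulrC /char_poly -!det_mulmx; congr (\det _).
rewrite /char_poly_mx mulmxBl mulmxBr -!map_mxM AP; congr (_ - _).
by rewrite scalar_mxC.
Qed.

(** Right multiplication by the block matrix with rows [s, 0] and [- r, 1] clears the lower left
    corner, because diagonal matrices commute; the nonzero determinant of [s] then cancels. *)
Lemma det_block_diag (K : idomainType) n (p q r s : 'rV[K]_n) :
    (forall j, s 0 j != 0) ->
  \det (block_mx (diag_mx p) (diag_mx q) (diag_mx r) (diag_mx s)) =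
  \prod_j (p 0 j * s 0 j - q 0 j * r 0 j).
Proof.
move=> s0; have ds : \det (diag_mx s) != 0.
  by rewrite det_diag; apply/prodf_neq0 => j _; apply: s0.
apply: (mulIf ds).
have -> : \det (diag_mx s) = \det (block_mx (diag_mx s) 0 (- diag_mx r) 1%:M).
  by rewrite det_lblock det1 mulr1.
rewrite -det_mulmx mulmx_block !mulmx1 !mulmx0 !add0r !mulmxN.
rewrite !mulmx_diag.
have -> : \row_i (r 0 i * s 0 i) = \row_i (s 0 i * r 0 i).
  by apply/rowP => i; rewrite !mxE mulrC.
rewrite subrr det_ublock det_lblock det1 mulr1; congr (_ * _).
rewrite -linearB det_diag.
by apply: eq_bigr => j _; rewrite !mxE.
Qed.

Lemma det_castmx (K : comNzRingType) m n (e : m = n) (A : 'M[K]_m) :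
  \det (castmx (e, e) A) = \det A.
Proof. by case: _ / e. Qed.

(** The index [(a, p)] is encoded as [a * n + p], so after a cast to size [n + n] the characteristic
    matrix has four diagonal blocks, and ['X - (G 1 1 p)%:P] is never zero. *)
Lemma char_poly_tens_diag (K : fieldType) n (G : 'I_2 -> 'I_2 -> 'I_n -> K)
    (A : 'M[K]_(2 * n)) :
    (forall a b p q, A (mxtens_index (a, p)) (mxtens_index (b, q)) =
                     G a b p *+ (p == q)) ->
  char_poly A =
  \prod_p (('X - (G 0 0 p)%:P) * ('X - (G 1 1 p)%:P)
           - (G 0 1 p * G 1 0 p)%:P).
Proof.
move=> AE; have e : (2 * n = n + n)%N by rewrite mul2n addnn.
have el p : cast_ord (esym e) (lshift n p) = mxtens_index (0, p).
  exact/val_inj.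
have er p : cast_ord (esym e) (rshift n p) = mxtens_index (1, p).
  by apply/val_inj; rewrite /= mul1n.
have idx a b p q : (mxtens_index (a, p) == mxtens_index (b, q) :> 'I_(2 * n))
    = (a == b) && (p == q).
  by rewrite (inj_eq (can_inj (@mxtens_indexK 2 n))).
rewrite /char_poly -(det_castmx e).
have -> : castmx (e, e) (char_poly_mx A) =
    block_mx (diag_mx (\row_p ('X - (G 0 0 p)%:P)))
             (diag_mx (\row_p (- (G 0 1 p)%:P)))
             (diag_mx (\row_p (- (G 1 0 p)%:P)))
             (diag_mx (\row_p ('X - (G 1 1 p)%:P))).
  apply/matrixP => i j; rewrite castmxE /=.
  case: (split_ordP i) => p ->; case: (split_ordP j) => q ->;
  rewrite ?block_mxEul ?block_mxEur ?block_mxEdl ?block_mxEdr ?el ?er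
    /char_poly_mx !mxE idx AE /=;
  by case: (p == q); rewrite ?mulr1n ?mulr0n ?subr0 ?sub0r ?oppr0.
rewrite det_block_diag => [|j]; last by rewrite mxE polyXsubC_eq0.
by apply: eq_bigr => p _; rewrite !mxE mulrNN polyCM.
Qed.

(** * Points of the unit circle and the eigenvalues of the ring matrices *)

Definition cis (R : realType) (t : R) : R[i] := Complex (cos t) (sin t).

Lemma cisD (R : realType) (t u : R) : cis (t + u) = cis t * cis u.
Proof.
rewrite /cis cosD sinD.
by apply/eqP; rewrite eq_complex /= eqxx addrC eqxx.
Qed.

Lemma cisX (R : realType) (t : R) n : cis t ^+ n = cis (t *+ n).
Proof.
elim: n => [|n IHn]; first by rewrite expr0 mulr0n /cis cos0 sin0.
by rewrite exprS IHn mulrS cisD.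
Qed.

Definition ring_freq (R : realType) N j : R := (pi *+ 2 / N%:R) *+ j.

(** With [w = cis (ring_freq R N j)], this is [2 - w - w^-1], and [skew_eig] is [w^-1 - w]. *)
Definition laplacian_eig (R : realType) N j : R :=
  2 - 2 * cos (ring_freq R N j).

Definition skew_eig (R : realType) N j : R[i] :=
  Complex 0 (- (2 * sin (ring_freq R N j))).

Lemma laplacian_eig_sin (R : realType) N j :
  laplacian_eig R N j = 4 * sin (pi * j%:R / N%:R) ^+ 2.
Proof.
rewrite /laplacian_eig.
have -> : ring_freq R N j = pi * j%:R / N%:R + pi * j%:R / N%:R.
  by rewrite /ring_freq -mulr_natr; ring.
by rewrite cosD -!expr2 cos2sin2; ring.
Qed.

Lemma laplacian_eig0 (R : realType) N : laplacian_eig R N 0 = 0.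
Proof. by rewrite /laplacian_eig /ring_freq mulr0n cos0 mulr1 subrr. Qed.

Lemma sin_pi_div_gt0 (R : realType) N j : (0 < j < N)%N ->
  0 < sin (pi * j%:R / N%:R : R).
Proof.
move=> /andP[j0 jN]; have N0 : 0 < N%:R :> R by rewrite ltr0n; lia.
apply: sin_gt0_pi; apply/andP; split.
  by rewrite divr_gt0 // mulr_gt0 ?pi_gt0 ?ltr0n.
by rewrite ltr_pdivrMr // ltr_pM2l ?pi_gt0 // ltr_nat.
Qed.

Lemma laplacian_eig_gt0 (R : realType) N j : (0 < j < N)%N ->
  0 < laplacian_eig R N j.
Proof.
move=> jN; rewrite laplacian_eig_sin mulr_gt0 ?ltr0n //.
by rewrite exprn_gt0 // sin_pi_div_gt0.
Qed.

Lemma laplacian_eig_ge0 (R : realType) N j : 0 <= laplacian_eig R N j.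
Proof. by rewrite laplacian_eig_sin mulr_ge0 // sqr_ge0. Qed.

Lemma le_sin_pi_div (R : realType) N j : (0 < j < N)%N ->
  sin (pi / N%:R) <= sin (pi * j%:R / N%:R) :> R.
Proof.
move=> /andP[j0 jN]; have N0 : 0 < N%:R :> R by rewrite ltr0n; lia.
have p0 := pi_gt0 R.
have j1 : 1 <= j%:R :> R by rewrite ler1n.
have jN1 : j%:R + 1 <= N%:R :> R by rewrite natr1 ler_nat.
(* sin (a + b) - sin (a - b) = 2 cos a sin b *)
pose a : R := pi * (j%:R + 1) / (2 * N%:R).
pose b : R := pi * (j%:R - 1) / (2 * N%:R).
have -> : pi / N%:R = a - b :> R by rewrite /a /b; field; lra.
have -> : pi * j%:R / N%:R = a + b :> R by rewrite /a /b; field; lra.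
rewrite -subr_ge0 sinB sinD.
have -> : sin a * cos b + cos a * sin b - (sin a * cos b - cos a * sin b)
  = 2 * (cos a * sin b) by ring.
have d0 : 0 < 2 * N%:R :> R by rewrite mulr_gt0.
rewrite !mulr_ge0 //.
(* From [j + 1 <= N], [a] lies in [[0, pi / 2]]; [b] lies in [[0, pi]], with [1 <= j] for the lower
   bound. *)
- apply: cos_ge0_pihalf; apply/andP; split.
    apply: (@le_trans _ _ 0); first lra.
    by rewrite /a divr_ge0 ?mulr_ge0 ?ltW //; lra.
  rewrite /a ler_pdivrMr //.
  have -> : pi / 2 * (2 * N%:R) = pi * N%:R :> R by field.
  by rewrite ler_pM2l.
- apply: sin_ge0_pi; apply/andP; split.
    by rewrite /b divr_ge0 ?mulr_ge0 ?(ltW d0) ?(ltW p0) ?subr_ge0.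
  by rewrite /b ler_pdivrMr // ler_pM2l //; lra.
Qed.

Lemma cis_freqXN (R : realType) N j : (0 < N)%N ->
  cis (ring_freq R N j) ^+ N = 1.
Proof.
move=> N0; have N0' : N%:R != 0 :> R by rewrite pnatr_eq0; lia.
have h : cis (pi *+ 2 / N%:R : R) ^+ N = 1.
  rewrite cisX -[_ *+ N]mulr_natr divfK // /cis cos2pi.
  by rewrite -[pi *+ 2]add0r sinD2pi sin0.
by rewrite /ring_freq -cisX exprAC h expr1n.
Qed.

Lemma cis_freq_neq1 (R : realType) N j : (0 < j < N)%N ->
  cis (ring_freq R N j) != 1.
Proof.
move=> /(laplacian_eig_gt0 R); apply: contraTN => /eqP[c1 _].
by rewrite /laplacian_eig c1 mulr1 subrr ltxx.
Qed.

(** * The Fourier matrix *)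

Definition fourier_mx (R : realType) N : 'M[R[i]]_N :=
  Vandermonde N (\row_j cis (ring_freq R N j)).

Lemma fourier_mxE (R : realType) N (i j : 'I_N) :
  fourier_mx R N i j = cis (ring_freq R N j) ^+ i.
Proof. by rewrite !mxE. Qed.

Lemma cis_neq0 (R : realType) (t : R) : cis t != 0.
Proof.
apply/eqP => -[c0 s0]; have := cos2Dsin2 t.
by rewrite c0 s0 expr0n /= addr0 => /esym/eqP; rewrite oner_eq0.
Qed.

(** The Vandermonde nodes are distinct: for [i < j] the quotient of nodes [j] and [i] is node
    [j - i], which differs from 1. *)
Lemma fourier_mx_unit (R : realType) N : fourier_mx R N \in unitmx.
Proof.
rewrite unitmxE det_Vandermonde unitfE.
apply/prodf_neq0 => i _; apply/prodf_neq0 => j ij; rewrite !mxE.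
have -> : ring_freq R N j = ring_freq R N (j - i) + ring_freq R N i.
  by rewrite /ring_freq -mulrnDr subnK // ltnW.
rewrite cisD -[X in _ - X]mul1r -mulrBl mulf_neq0 ?cis_neq0 // subr_eq0.
by apply: cis_freq_neq1; have := ltn_ord j; lia.
Qed.

(** * Cyclic neighbours *)

Lemma ord_pred_eq n (i j : 'I_n) : (ord_pred i == j) = (i == ordS j).
Proof.
by apply/eqP/eqP => [<-|->]; [rewrite ord_predK | rewrite ordSK].
Qed.

Lemma ordS_neq n (i : 'I_n) : (1 < n)%N -> (ordS i == i) = false.
Proof.
move=> n1; apply/negP => /eqP/(congr1 val) /=; have := ltn_ord i.
rewrite leq_eqVlt => /orP[/eqP e|lt]; last by rewrite modn_small //; lia.
by rewrite e modnn; lia.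
Qed.

(** Equivalently, the two neighbours of a vertex are distinct. On a ring of two vertices they
    coincide, and the ring matrices are no longer the combinations of shifts used below. *)
Lemma ordSS_neq n (i : 'I_n) : (2 < n)%N -> (ordS (ordS i) == i) = false.
Proof.
move=> n2; apply/negP => /eqP/(congr1 val) /=; have := ltn_ord i.
rewrite leq_eqVlt => /orP[/eqP e|lt]; first by rewrite e modnn modn_small; lia.
rewrite (modn_small lt); move: lt.
rewrite leq_eqVlt => /orP[/eqP e|lt]; last by rewrite modn_small //; lia.
by rewrite e modnn; lia.
Qed.

Lemma eq_modS n (i j : 'I_n) : (j == i + 1 %[mod n])%N = (ordS i == j).
Proof. by rewrite (modn_small (ltn_ord j)) addn1 eq_sym. Qed.

(** * Simultaneous diagonalisation of the ring matrices *)

Section RingCirculants.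

Variables (R : realType) (N : nat).
Hypothesis N3 : (2 < N)%N.

(** The row selections of [1%:M] are the two cyclic shifts; multiplying by them on the left only
    reindexes rows. *)
Lemma ring_laplacianE : ring_laplacian R N =
  2%:M - rowsub (@ordS N) 1%:M - rowsub (@ord_pred N) 1%:M.
Proof.
apply/matrixP => i j; rewrite !mxE !eq_modS ord_pred_eq.
rewrite (eq_sym (ordS j) i).
case: (i =P j) => [->|_].
  by rewrite ordS_neq 1?(eq_sym j) ?ordS_neq ?subr0 ?mulr1n //; lia.
case: (i =P ordS j) => [->|_]; first by rewrite ordSS_neq // mulr0n subr0 sub0r.
by case: (ordS i == j); rewrite ?mulr0n ?mulr1n ?subr0 ?sub0r.
Qed.

Lemma ring_skewE : ring_skew R N =
  rowsub (@ord_pred N) 1%:M - rowsub (@ordS N) 1%:M.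
Proof.
apply/matrixP => i j; rewrite !mxE !eq_modS ord_pred_eq.
rewrite (eq_sym (ordS j) i).
case: (i =P ordS j) => [->|_]; first by rewrite ordSS_neq // subr0.
by case: (ordS i == j); rewrite ?sub0r ?subr0 ?oppr0.
Qed.

Let V := fourier_mx R N.

(** Row [i] of [V] holds the [i]-th powers of the nodes; the wrap-around in the last row is harmless
    since the nodes are [N]-th roots of unity. *)
Let rowsub_ordS : rowsub (@ordS N) V =
  V *m diag_mx (\row_j cis (ring_freq R N j)).
Proof.
apply/matrixP => i j; rewrite mul_mx_diag [LHS]mxE [RHS]mxE !fourier_mxE mxE /=.
by rewrite expr_mod ?exprSr // cis_freqXN //; lia.
Qed.

Let cisV (t : R) : (cis t)^-1 = Complex (cos t) (- sin t).
Proof.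
apply: (mulfI (cis_neq0 t)); rewrite mulfV ?cis_neq0 //.
apply/eqP; rewrite eq_complex /= mulrN opprK -!expr2 cos2Dsin2 eqxx /=.
by apply/eqP; ring.
Qed.

Let rowsub_ord_pred : rowsub (@ord_pred N) V =
  V *m diag_mx (\row_j (cis (ring_freq R N j))^-1).
Proof.
apply/matrixP => i j; rewrite mul_mx_diag [LHS]mxE [RHS]mxE [X in _ * X]mxE.
apply: (canRL (mulfK (cis_neq0 _))).
(* The backward shift is the forward one read at the predecessor row. *)
have /matrixP/(_ (ord_pred i) j) := rowsub_ordS.
by rewrite mul_mx_diag [LHS]mxE [RHS]mxE [X in _ * X]mxE ord_predK.
Qed.

Lemma ring_laplacian_fourier :
  map_mx (real_complex R) (ring_laplacian R N) *m V =
  V *m diag_mx (\row_j (laplacian_eig R N j)%:C%C).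
Proof.
rewrite ring_laplacianE !map_mxB !map_mxsub map_mx1 map_scalar_mx.
rewrite !mulmxBl !mul_rowsub_mx !mul1mx rowsub_ordS rowsub_ord_pred.
rewrite -scalar_mxC -!mulmxBr; congr (_ *m _).
rewrite -diag_const_mx -!linearB; congr diag_mx.
apply/rowP => j; rewrite !mxE cisV /cis /laplacian_eig.
by apply/eqP; rewrite eq_complex /=; apply/andP; split; apply/eqP; ring.
Qed.

Lemma ring_skew_fourier :
  map_mx (real_complex R) (ring_skew R N) *m V =
  V *m diag_mx (\row_j (skew_eig R N j)).
Proof.
rewrite ring_skewE map_mxB !map_mxsub map_mx1.
rewrite !mulmxBl !mul_rowsub_mx !mul1mx rowsub_ordS rowsub_ord_pred.
rewrite -!mulmxBr; congr (_ *m _).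
rewrite -linearB; congr diag_mx.
apply/rowP => j; rewrite !mxE cisV /cis /skew_eig.
by apply/eqP; rewrite eq_complex /=; apply/andP; split; apply/eqP; ring.
Qed.

End RingCirculants.

(** * Intertwining relations and the list of eigenvalues *)

Lemma tensmx_intertwine (K : comNzRingType) m n (A : 'M[K]_m)
    (V X Y : 'M[K]_n) :
  X *m V = V *m Y -> (A *t X) *m (1%:M *t V) = (1%:M *t V) *m (A *t Y).
Proof. by move=> XV; rewrite !tensmx_mul mulmx1 mul1mx XV. Qed.

Lemma intertwineD (K : comNzRingType) n (P A1 A2 B1 B2 : 'M[K]_n) :
  A1 *m P = P *m B1 -> A2 *m P = P *m B2 -> (A1 + A2) *m P = P *m (B1 + B2).
Proof. by move=> E1 E2; rewrite mulmxDl mulmxDr E1 E2. Qed.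

Lemma intertwineZ (K : comNzRingType) n (a : K) (P A B : 'M[K]_n) :
  A *m P = P *m B -> (a *: A) *m P = P *m (a *: B).
Proof. by move=> E; rewrite -scalemxAl -scalemxAr E. Qed.

Lemma char_poly_eigenvalues (R : realType) n (A : 'M[R]_n) :
  char_poly (map_mx (real_complex R) A) =
  \prod_(z <- eigenvalues A) ('X - z%:P).
Proof.
rewrite /eigenvalues; case: closed_field_poly_normal => r /= {1}->.
by rewrite (eqP (char_poly_monic _)) scale1r.
Qed.

(** * Fourier modes of the state matrix *)

Section StateMatrix.

Variables (R : realType) (N : nat).
Hypothesis N3 : (2 < N)%N.
Variables (alpha beta c s : R).

Let toC := real_complex R.
Let F := state_matrix N alpha beta c s.

(* The eigenvalues of mode [j] are the roots of [w^2 + w/2 = mode_coupling j],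
   shifted by [- i mode_offset j]. *)
Definition mode_offset j : R := - (beta * s * sin (ring_freq R N j)).

Definition mode_coupling j : R :=
  let x := beta * c * laplacian_eig R N j in (4 * alpha * x - x ^+ 2) / 4.

(** Characteristic polynomial of the block of mode [j]; [mode_coupling j] is the product of the
    off-diagonal entries [x / 2] and [(4 alpha - x) / 2]. *)
Definition mode_poly j : {poly R[i]} :=
  ('X - (toC (- 2^-1) - Complex 0 (mode_offset j))%:P)
  * ('X - (- Complex 0 (mode_offset j))%:P) - (toC (mode_coupling j))%:P.

Lemma char_poly_state_matrix :
  char_poly (map_mx toC F) = \prod_(j < N) mode_poly j.
Proof.
pose P : 'M[R[i]]_(2 * N) := 1%:M *t fourier_mx R N.
pose D : 'M[R[i]]_(2 * N) := (toC 2^-1) *: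
  (map_mx toC (mx22 (-1) 0 (4 * alpha) 0) *t 1%:M
   + map_mx toC (mx22 0 (beta * c) (- (beta * c)) 0)
       *t diag_mx (\row_j toC (laplacian_eig R N j))
   + map_mx toC (mx22 (- (beta * s)) 0 0 (- (beta * s)))
       *t diag_mx (\row_j skew_eig R N j)).
have uP : P \in unitmx by rewrite tensmx_unit ?unitmx1 ?fourier_mx_unit //; lia.
have FP : map_mx toC F *m P = P *m D.
  rewrite /F /state_matrix map_mxZ !map_mxD !map_mxT map_mx1.
  apply: intertwineZ; do 2?apply: intertwineD; apply: tensmx_intertwine.
  - by rewrite mul1mx mulmx1.
  - exact: ring_laplacian_fourier.
  - exact: ring_skew_fourier.
rewrite (char_poly_similar uP FP).
(* Entry [(a, b)] of the block of mode [j] in [D]. *)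
pose G (a b : 'I_2) (j : 'I_N) : R[i] := toC 2^-1 *
  (toC (mx22 (-1) 0 (4 * alpha) 0 a b)
   + toC (mx22 0 (beta * c) (- (beta * c)) 0 a b) * toC (laplacian_eig R N j)
   + toC (mx22 (- (beta * s)) 0 0 (- (beta * s)) a b) * skew_eig R N j).
rewrite (@char_poly_tens_diag _ _ G).
  apply: eq_bigr => j _; rewrite /mode_poly /G !mxE /=.
  congr (('X - _%:P) * ('X - _%:P) - _%:P);
  apply/eqP; rewrite eq_complex /mode_offset /mode_coupling /=;
  by apply/andP; split; apply/eqP; field.
move=> a b p q; rewrite /D mxE [X in _ * X]mxE [X in _ * (X + _)]mxE.
rewrite !tensmxE /G !mxE.
by case: (p =P q) => [->|_];
  rewrite ?mulr1n ?mulr0n ?mulr0 ?addr0 ?mulr0 ?mulr1.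
Qed.

Lemma mode_poly0 : mode_poly 0 = 'X * ('X - (- toC 2^-1)%:P).
Proof.
rewrite /mode_poly /mode_offset /mode_coupling laplacian_eig0.
rewrite /ring_freq mulr0n sin0 !mulr0 expr0n subr0 mul0r oppr0.
rewrite -[Complex 0 0]/(0 : R[i]) rmorph0 rmorphN !subr0 oppr0 subr0.
by rewrite mulrC [toC (- _)]rmorphN.
Qed.

Let j0 : 'I_N := Ordinal (ltnW (ltnW N3)).

Lemma zero_in_eigenvalues : 0 \in eigenvalues F.
Proof.
rewrite -root_prod_XsubC -char_poly_eigenvalues char_poly_state_matrix.
by rewrite (bigD1 j0) //= mode_poly0 !rootM rootX eqxx.
Qed.

Lemma eigenvalue_state_matrix0 : eigenvalue F 0.
Proof.
rewrite eigenvalue_root_char -(fmorph_root toC) map_char_poly rmorph0.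
by rewrite char_poly_eigenvalues root_prod_XsubC zero_in_eigenvalues.
Qed.

(** Deleting one 0 from the list amounts to cancelling one factor ['X], supplied by mode 0, whose
    other root is [- 1/2]. Any further zero root survives in the other modes. *)
Lemma remaining_eigenvaluesP z :
  reflect (z = - toC 2^-1 \/ exists2 j : 'I_N, (0 < j)%N & root (mode_poly j) z)
          (z \in rem 0 (eigenvalues F)).
Proof.
have /(mulfI (negbT (polyX_eq0 _))) E :
    'X * \prod_(z <- rem 0 (eigenvalues F)) ('X - z%:P) =
    'X * (('X - (- toC 2^-1)%:P) * \prod_(j < N | j != j0) mode_poly j).
  rewrite mulrA -mode_poly0; transitivity (\prod_(j < N) mode_poly j).
    rewrite -char_poly_state_matrix char_poly_eigenvalues.
    by rewrite [RHS](big_rem 0 zero_in_eigenvalues) /= polyC0 subr0.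
  by rewrite (bigD1 j0).
rewrite -root_prod_XsubC E rootM root_XsubC /root horner_prod.
apply: (iffP orP) => -[].
- by move/eqP; left.
- case/prodf_eq0 => j jN zj; right; exists j => //.
  by rewrite lt0n; apply: contraNneq jN => e; apply/eqP/val_inj.
- by move->; left.
- case=> j jp zj; right; apply/prodf_eq0; exists j => //.
  by rewrite -val_eqE -lt0n.
Qed.

(* After the imaginary shift, a root [w = a + i b] satisfies [w^2 + w/2 = p]:
   either [b = 0] and [a (a + 1/2) = p], or [a = - 1/4]. *)
Lemma mode_poly_roots_neg j :
  (forall z, root (mode_poly j) z -> complex.Re z < 0) <-> mode_coupling j < 0.
Proof.
have rootE a b : root (mode_poly j) (Complex a (b - mode_offset j)) =
    (a ^+ 2 + a / 2 - b ^+ 2 == mode_coupling j) && (2 * a * b + b / 2 == 0).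
  rewrite /root /mode_poly !hornerE eq_complex /=.
  by congr andb; rewrite -[RHS]subr_eq0; congr (_ == _); field.
split=> [neg|p0 [a b]].
  rewrite ltNge; apply/negP => p0.
  (* The larger real solution of [w^2 + w/2 = mode_coupling j], nonnegative when the right-hand side
     is. *)
  pose a := (Num.sqrt (1 / 4 + 4 * mode_coupling j) - 1 / 2) / 2.
  have d0 : 0 <= 1 / 4 + 4 * mode_coupling j by lra.
  have : root (mode_poly j) (Complex a (0 - mode_offset j)).
    rewrite rootE mulr0 mul0r addr0 eqxx andbT; apply/eqP.
    have := sqr_sqrtr d0; rewrite /a; set r := Num.sqrt _ => r2.
    have -> : mode_coupling j = (r ^+ 2 - 1 / 4) / 4 by rewrite r2; field.
    by field.
  move/neg => /=; rewrite ltNge => /negP; apply; rewrite /a.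
  have : 1 / 2 <= Num.sqrt (1 / 4 + 4 * mode_coupling j).
    rewrite -(@ler_pXn2r _ 2) ?nnegrE ?sqrtr_ge0 ?sqr_sqrtr //; lra.
  by lra.
rewrite -[b](subrK (mode_offset j)) /=.
have -> : b - mode_offset j + mode_offset j =
    b + mode_offset j - mode_offset j by rewrite addrK subrK.
rewrite rootE => /andP[/eqP re /eqP im].
(* This is half of the imaginary part [im]. *)
have /eqP : (a + 1 / 4) * (b + mode_offset j) = 0 by nra.
rewrite mulf_eq0 => /orP[/eqP ha|/eqP hb]; first lra.
(* Now [a * (a + 1/2)] is negative, which forces [a < 0]. *)
by move: re; rewrite hb expr0n subr0 => re; nra.
Qed.

Lemma remaining_eigenvalues_negP :
  remaining_eigenvalues_neg F <->
  forall j, (0 < j < N)%N -> mode_coupling j < 0.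
Proof.
split=> [neg j /andP[jp jN]|neg z /remaining_eigenvaluesP[->|[j jp]]].
- apply/mode_poly_roots_neg => z zj; apply/neg/remaining_eigenvaluesP; right.
  by exists (Ordinal jN).
- by rewrite /= oppr_lt0 invr_gt0.
- by move: z; apply/mode_poly_roots_neg; apply: neg; rewrite jp ltn_ord.
Qed.

End StateMatrix.

(** * The ordered spectrum of the Laplacian *)

Lemma char_poly_ring_laplacian (R : realType) N : (2 < N)%N ->
  char_poly (map_mx (real_complex R) (ring_laplacian R N)) =
  \prod_(j < N) ('X - ((laplacian_eig R N j)%:C%C)%:P).
Proof.
move=> N3.
rewrite (char_poly_similar (fourier_mx_unit R N) (ring_laplacian_fourier R N3)).
rewrite char_poly_trig ?diag_mx_is_trig //.
by apply: eq_bigr => j _; rewrite !mxE eqxx mulr1n.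
Qed.

Lemma eigenvalues_ring_laplacian (R : realType) N : (2 < N)%N ->
  perm_eq (eigenvalues (ring_laplacian R N))
    (map (real_complex R) (map (laplacian_eig R N) (iota 0 N))).
Proof.
move=> N3; apply: prod_XsubC_eq; rewrite -char_poly_eigenvalues.
rewrite char_poly_ring_laplacian // !big_map.
have -> : iota 0 N = index_iota 0 N by rewrite /index_iota subn0.
by rewrite big_mkord.
Qed.

Lemma ordered_laplacian_eigP (R : realType) N (lam : seq R) : (2 < N)%N ->
  ordered_real_eigenvalues (ring_laplacian R N) lam <->
  sorted <=%R lam /\ perm_eq lam (map (laplacian_eig R N) (iota 0 N)).
Proof.
move=> N3; rewrite /ordered_real_eigenvalues.
rewrite (permPl (eigenvalues_ring_laplacian R N3)) perm_sym.
split=> -[-> h]; split=> //; last exact: perm_map.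
exact: (perm_map_inj (@complexI _)) h.
Qed.

(** Sorted positions do not match Fourier modes, but the smallest eigenvalue 0 comes from mode 0, so
    the tail of the list is a rearrangement of the nonzero modes. *)
Lemma ordered_laplacian_eig_cons (R : realType) N (lam : seq R) : (2 < N)%N ->
  ordered_real_eigenvalues (ring_laplacian R N) lam ->
  exists2 lam', lam = 0 :: lam' &
    perm_eq lam' (map (laplacian_eig R N) (iota 1 N.-1)).
Proof.
move=> N3 /(ordered_laplacian_eigP _ N3)[].
have -> : map (laplacian_eig R N) (iota 0 N) =
    0 :: map (laplacian_eig R N) (iota 1 N.-1).
  by rewrite -[in LHS](ltn_predK N3) /= (ltn_predK N3) laplacian_eig0.
case: lam => [_ /perm_size //|x lam' srt pm].
(* The head is at most 0 because 0 occurs in the sorted list, and at least 0 because it is a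
   Laplacian eigenvalue. *)
have x0 : x = 0.
  apply: le_anti; apply/andP; split.
    have := perm_mem pm 0; rewrite !inE eqxx /= => /orP[/eqP-> //|].
    by move: srt; rewrite /= (path_sortedE le_trans) => /andP[/allP h _] /h.
  have := perm_mem pm x; rewrite mem_head inE => /esym/orP[/eqP-> //|].
  by case/mapP => j _ ->; apply: laplacian_eig_ge0.
by exists lam'; move: pm; rewrite x0 // perm_cons.
Qed.

(** * Stability criterion and two sufficient conditions *)

Theorem mainTheorem2 (R : realType) (N : nat) (hN : (3 <= N)%N)
    (alpha beta : R) (halpha : 0 < alpha) (k : nat) (hk : (k < N)%N) :
  let c : R := cos (2 * pi * k%:R / N%:R) in
  let s : R := sin (2 * pi * k%:R / N%:R) in
  let F : 'M[R]_(2 * N) := state_matrix N alpha beta c s in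
  [/\ eigenvalue F 0,
      exists lam : seq R, ordered_real_eigenvalues (ring_laplacian R N) lam,
      forall lam : seq R,
        ordered_real_eigenvalues (ring_laplacian R N) lam ->
        lam`_0 = 0 /\
        (remaining_eigenvalues_neg F <->
         forall i : nat, (1 <= i < N)%N ->
           let x : R := beta * c * lam`_i in 4 * alpha * x - x ^+ 2 < 0)
    & (beta * c < 0 -> remaining_eigenvalues_neg F) /\
      (beta * c > alpha * (sin (pi / N%:R))^-1 ^+ 2 ->
         remaining_eigenvalues_neg F)].
Proof.
move=> c s F; split.
- exact: eigenvalue_state_matrix0.
- exists (sort <=%R (map (laplacian_eig R N) (iota 0 N))).
  apply/(ordered_laplacian_eigP _ hN).
  by rewrite sort_le_sorted perm_sort.
- move=> lam /(ordered_laplacian_eig_cons hN)[lam' -> pm]; split=> //.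
  rewrite remaining_eigenvalues_negP //.
  have sz : size lam' = N.-1 by rewrite (perm_size pm) size_map size_iota.
  split=> neg.
  + case=> [|i] //= iN.
    have : lam'`_i \in map (laplacian_eig R N) (iota 1 N.-1).
      by rewrite -(perm_mem pm) mem_nth // sz; lia.
    case/mapP => j; rewrite mem_iota => jN ->.
    have /neg : (0 < j < N)%N by lia.
    by rewrite /mode_coupling pmulr_llt0 // invr_gt0.
  + move=> j jN; rewrite /mode_coupling pmulr_llt0 ?invr_gt0 //.
    have : laplacian_eig R N j \in lam'.
      by rewrite (perm_mem pm) map_f // mem_iota; lia.
    case/(nthP 0) => i; rewrite sz => iN <-.
    (* The position is shifted by one because the full list starts with the extra 0. *)
    by apply: (neg i.+1); lia.
- split=> hc; apply/remaining_eigenvalues_negP => // j jN;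
    rewrite /mode_coupling pmulr_llt0 ?invr_gt0 //;
    have l0 := laplacian_eig_gt0 R jN.
  + have x0 : beta * c * laplacian_eig R N j < 0 by rewrite pmulr_llt0.
    by nra.
  + have s0 : 0 < sin (pi / N%:R) :> R.
      by have := @sin_pi_div_gt0 R N 1; rewrite mulr1; apply; lia.
    have ls : 4 * sin (pi / N%:R) ^+ 2 <= laplacian_eig R N j.
      rewrite laplacian_eig_sin ler_pM2l // ler_pXn2r ?nnegrE ?(ltW s0) //.
        exact: le_sin_pi_div.
      exact/ltW/sin_pi_div_gt0.
    (* Past [4 alpha] the second factor of [x * (4 alpha - x)] is negative while [x] is positive. *)
    have x4 : 4 * alpha < beta * c * laplacian_eig R N j.
      have s20 : 0 < sin (pi / N%:R) ^+ 2 :> R by rewrite exprn_gt0.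
      have b0 : alpha < beta * c * sin (pi / N%:R) ^+ 2.
        by move: hc; rewrite exprVn ltr_pdivrMr.
      have bc : 0 < beta * c.
        by rewrite -(pmulr_lgt0 _ s20) (lt_trans halpha).
      have := ler_wpM2l (ltW bc) ls; lra.
    by nra.
Qed.
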